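(* Let $m\ge k$ and $L\ge2$ be integers, and assume $L>2$ if $m<2k$. Let $E$ be an $m\times k$ random matrix with independent $\mathcal N(0,1)$ entries. Then for any $\eta$ with $0<\eta<1-\frac{1}{\lfloor m/k\rfloor(L-1)}$, $$\mathscr D_{\mathrm a}(E,L)<8e\,m^{3/2}L^{-(1-\eta)\lfloor m/k\rfloor}$$ with probability at least $1-L^{-\eta\lfloor m/k\rfloor}e^{\eta/(1-\eta)}-e^{-2m}$.
   Context: For a $k\times m$ matrix $F$, finite $\mathscr A\subset\mathbb{R}$ and bounded $\mathscr X\subset\mathbb{R}^k$, $\mathscr D_{\mathrm s}(F,\mathscr A,\mathscr X):=\sup_{x\in\mathscr X}\inf_{q\in\mathscr A^m}\|x-Fq\|_2$; for an $m\times k$ matrix $E$, $\mathscr D_{\mathrm a}(E,\mathscr A,\mathscr X):=\inf\{\mathscr D_{\mathrm s}(F,\mathscr A,\mathscr X):FE=I_k\}$ (infimum over empty set is $+\infty$); and $\mathscr D_{\mathrm a}(E,L):=\inf_{|\mathscr A|=L}\mathscr D_{\mathrm a}(E,\mathscr A,B_1)$ with $B_1$ the closed unit Euclidean ball of $\mathbb{R}^k$. *)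

(* Defs.v *)
From HB Require Import structures.
From mathcomp Require Import all_boot all_order all_algebra.
From mathcomp Require Import all_classical all_reals all_analysis.
Set Implicit Arguments. Unset Strict Implicit. Unset Printing Implicit Defensive.
Import Order.TTheory GRing.Theory Num.Theory.
Local Open Scope classical_set_scope.
Local Open Scope ring_scope.

Section defs.
Context {R : realType}.

Definition norm2 {n : nat} (v : 'cV[R]_n) : R := Num.sqrt (\sum_(i < n) (v i 0) ^+ 2).

Definition unit_ball (k : nat) : set 'cV[R]_k := [set x | norm2 x <= 1].

Definition alphabet_vecs (A : seq R) (m : nat) : set 'cV[R]_m :=
  [set q | forall i, q i 0 \in A].

Definition Ds {k m : nat} (F : 'M[R]_(k, m)) (A : seq R) (X : set 'cV[R]_k) : \bar R :=
  ereal_sup [set ereal_inf [set (norm2 (x - F *m q))%:E | q in @alphabet_vecs A m]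
            | x in X].

(* D_a(E, A, X) = inf { D_s(F, A, X) : F E = I_k }  (inf of empty set = +oo) *)
Definition Da {m k : nat} (E : 'M[R]_(m, k)) (A : seq R) (X : set 'cV[R]_k) : \bar R :=
  ereal_inf [set Ds F A X | F in [set F : 'M[R]_(k, m) | F *m E = 1%:M]].

Definition DaL {m k : nat} (E : 'M[R]_(m, k)) (L : nat) : \bar R :=
  ereal_inf [set Da E A (@unit_ball k) | A in [set A : seq R | uniq A /\ size A = L]].

Definition iid_std_gaussian_matrix {d : measure_display} {T : measurableType d}
  (P : probability T R) {m k : nat} (E : 'I_m -> 'I_k -> T -> R) : Prop :=
  [/\ (forall i j, measurable_fun setT (E i j)),
      (forall i j (B : set R), measurable B ->
          P (E i j @^-1` B) = normal_prob 0 1 B) &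
      (forall B : 'I_m -> 'I_k -> set R, (forall i j, measurable (B i j)) ->
          P (\bigcap_(p in [set: 'I_m * 'I_k]) (E p.1 p.2 @^-1` B p.1 p.2)) =
          (\prod_(p : 'I_m * 'I_k) P (E p.1 p.2 @^-1` B p.1 p.2))%E)].

End defs.

(* Main.v *)
Require Import Defs.
From HB Require Import structures.
From mathcomp Require Import all_boot all_order all_algebra.
From mathcomp Require Import all_classical all_reals all_analysis.
From mathcomp Require Import measurable_realfun.
From mathcomp Require Import ring lra.
Set Implicit Arguments. Unset Strict Implicit. Unset Printing Implicit Defensive.
Import Order.TTheory GRing.Theory Num.Theory.
Local Open Scope classical_set_scope.
Local Open Scope ring_scope.

(**
Let l = m %/ k, let V be the k x m matrix acting on k blocks of l rows with the
weights 1, L, ..., L^(l-1), and put A = V E, F = A^-1 V, so that F E = 1. For the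
equispaced alphabet of spacing 2 delta, each coordinate of V q runs over an
arithmetic progression of L^l points with spacing 2 delta, which covers the range
of A x when every row of E has norm at most delta (L - 1). Rounding the
coordinates of A x greedily (a derandomised mean-zero rounding) gives
|x - F q| <= delta |A^-1|_F, with the Frobenius norm.

The rows of E all have squared norm at most 14 m except with probability
e^(-2m), by the exponential moment E exp(g^2/4) = sqrt 2. The squared norm of the
c-th row of A^-1 is N_c / det(A)^2, where N_c is the sum of the squared
cofactors of column c; given the other columns, det(A) / sqrt(N_c) is a centred Gaussian of
variance v >= L^(2(l-1)). Bounding min(1, 1/y) by a mixture of Gaussian
exponentials, whose expectations are explicit, yields
P(|A^-1|_F^2 >= S) <= k (e^2/2) / sqrt(S v), and S is chosen to make this equal
to L^(-eta l).
*)

(** * One-dimensional Gaussian integrals *)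

(** The Radon-Nikodym derivative of [normal_prob] and [normal_pdf] have the same integral over every
    measurable set, hence agree almost everywhere. *)
Lemma ge0_integral_normal_prob (R : realType) (m s : R) (f : R -> \bar R) :
  (forall x, (0 <= f x)%E) -> measurable_fun setT f ->
  (\int[normal_prob m s]_x f x =
   \int[lebesgue_measure]_x (f x * (normal_pdf m s x)%:E))%E.
Proof.
move=> f0 mf.
have dom := @normal_prob_dominates R m s.
rewrite -(Radon_Nikodym_SigmaFinite.change_of_variables dom)//.
apply: ae_eq_integral => //.
- apply: emeasurable_funM => //.
  exact: measurable_int (Radon_Nikodym_SigmaFinite.f_integrable dom).
- apply: emeasurable_funM => //; apply/measurable_EFinP.
  exact: measurable_normal_pdf.
- apply: ae_eqe_mul2l => /=.
  apply: integral_ae_eq => //=.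
  + exact: Radon_Nikodym_SigmaFinite.f_integrable.
  + by apply/measurable_EFinP; exact: measurable_normal_pdf.
  + by move=> A _ mA; rewrite -Radon_Nikodym_SigmaFinite.f_integral.
Qed.

(** A Gaussian integral is evaluated by completing the square: the integrand becomes a multiple of
    another normal density, whose mass is one, so only an algebraic identity of densities remains to
    be checked. *)
Lemma integral_normal_prob_scale (R : realType) (h : R -> R) (C mu s : R) :
  measurable_fun setT h -> (forall x, 0 <= h x) -> 0 <= C ->
  (forall x, h x * normal_pdf 0 1 x = C * normal_pdf mu s x) ->
  (\int[normal_prob 0 1]_x (h x)%:E = C%:E)%E.
Proof.
move=> mh h0 C0 hE; rewrite ge0_integral_normal_prob//; last first.
  exact/measurable_EFinP.
under eq_integral do rewrite -EFinM hE EFinM.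
rewrite ge0_integralZl//.
- by rewrite integral_normal_pdf mule1.
- by apply/measurable_EFinP; exact: measurable_normal_pdf.
- by move=> x _; rewrite lee_fin normal_pdf_ge0.
Qed.

Lemma integral_normal_prob_expR_sqr (R : realType) :
  (\int[normal_prob 0 1]_x (expR (x ^+ 2 / 4))%:E = (Num.sqrt 2 : R)%:E)%E.
Proof.
have s2 : 0 < Num.sqrt 2 :> R by rewrite sqrtr_gt0.
apply: (@integral_normal_prob_scale _ _ _ 0 (Num.sqrt 2)).
- apply: measurableT_comp => //; apply: measurable_funM => //.
- by move=> x; rewrite expR_ge0.
- exact: ltW.
- move=> x; rewrite !normal_pdfE ?gt_eqF// /normal_peak /normal_fun.
  rewrite mulrCA -expRD [RHS]mulrA; congr (_ * _).
    rewrite sqr_sqrtr// expr1n mul1r -mulrnAr sqrtrM//.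
    by rewrite invfM mulrA divff ?mul1r// gt_eqF.
  by congr expR; rewrite sqr_sqrtr// expr1n subr0; field.
Qed.

Lemma integral_normal_prob_gauss (R : realType) (a b tau : R) : 0 < tau ->
  (\int[normal_prob 0 1]_x (expR (- (a * x + b) ^+ 2 / (2 * tau)))%:E =
   (Num.sqrt (tau / (tau + a ^+ 2)) *
    expR (- b ^+ 2 / (2 * (tau + a ^+ 2))))%:E)%E.
Proof.
move=> t0; have ta0 : 0 < tau + a ^+ 2 by rewrite ltr_pwDl ?sqr_ge0.
set s := Num.sqrt _; have s2 : s ^+ 2 = tau / (tau + a ^+ 2).
  by rewrite sqr_sqrtr// divr_ge0 ?ltW.
have s0 : 0 < s by rewrite sqrtr_gt0 divr_gt0.
(* Completing the square in [x] gives a normal density of mean [- (a * b) / (tau + a ^+ 2)] and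
   variance [tau / (tau + a ^+ 2)]. *)
apply: (@integral_normal_prob_scale _ _ _ (- (a * b) / (tau + a ^+ 2)) s).
- apply: measurableT_comp => //; apply: measurable_funM => //.
  apply: measurableT_comp => //; apply: measurable_funX.
  by apply: measurable_funD => //; exact: measurable_funM.
- by move=> x; rewrite expR_ge0.
- by rewrite mulr_ge0 ?expR_ge0 ?ltW.
- move=> x; rewrite !normal_pdfE ?gt_eqF// /normal_peak /normal_fun.
  rewrite mulrCA -expRD [RHS]mulrACA -expRD; congr (_ * _).
    rewrite expr1n mul1r -mulrnAr sqrtrM ?sqr_ge0// sqrtr_sqr gtr0_norm//.
    by rewrite invfM mulrA divff ?mul1r// gt_eqF.
  by congr expR; rewrite s2 expr1n subr0; field; rewrite !gt_eqF.
Qed.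

(** * Independence as resampling of one coordinate *)

(** The product rule on rectangles identifies the joint law with the product measure by uniqueness;
    Tonelli then gives the iterated integral. *)
Lemma ge0_integral_indep_pair (d d1 d2 : measure_display) (T : measurableType d)
    (T1 : measurableType d1) (T2 : measurableType d2) (R : realType)
    (P : probability T R) (nu : probability T2 R)
    (Y : {mfun T >-> T1}) (X : {mfun T >-> T2}) (f : T1 * T2 -> \bar R) :
  (forall A B, measurable A -> measurable B ->
     P (Y @^-1` A `&` X @^-1` B) = (P (Y @^-1` A) * nu B)%E) ->
  measurable_fun setT f -> (forall z, (0 <= f z)%E) ->
  (\int[P]_t f (Y t, X t) = \int[P]_t \int[nu]_x f (Y t, x))%E.
Proof.
move=> YX mf f0.
have mYX : measurable_fun setT (fun t => (Y t, X t)).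
  by apply: measurable_fun_pair => //.
pose YXm := isMeasurableFun.Build _ _ _ _ _ mYX.
pose YX' : {mfun T >-> (T1 * T2)%type} := HB.pack (fun t => (Y t, X t)) YXm.
rewrite -(ge0_integral_distribution YX' mf f0).
transitivity (\int[distribution P Y \x nu]_z f z)%E.
  apply: eq_measure_integral => /= A mA _; apply/esym.
  apply: product_measure_unique => //= B C mB mC.
rewrite fubini_tonelli1// ge0_integral_distribution//.
- exact: measurable_fun_fubini_tonelli_F.
- by move=> y; apply: integral_ge0.
Qed.

(** Quantifying over all measurable spaces [S] avoids a sigma-algebra on [I -> R]; the same
    hypothesis then serves on [T] and on a product where one coordinate has been replaced. *)
Definition measurable_in_coords {R : realType} {I : Type} {d' : measure_display}
    {U : sigmaRingType d'} (f : (I -> R) -> U) :=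
  forall (d : measure_display) (S : measurableType d) (Y : I -> S -> R),
    (forall j, measurable_fun setT (Y j)) ->
    measurable_fun setT (fun s => f (Y^~ s)).

Definition upd {R : Type} {I : eqType} (w : I -> R) (i : I) (x : R) : I -> R :=
  fun j => if j == i then x else w j.

Lemma upd_id (R : Type) (I : eqType) (w : I -> R) (i : I) : upd w i (w i) = w.
Proof. by apply/funext => j; rewrite /upd; case: eqP => [->|]. Qed.

Section std_gaussian_family.
Context {d : measure_display} {T : measurableType d} {R : realType}.
Context (P : probability T R) (I : finType) (X : I -> T -> R).
Hypothesis mX : forall i, measurable_fun setT (X i).
Hypothesis lawX : forall i (B : set R), measurable B ->
  P (X i @^-1` B) = normal_prob 0 1 B.
Hypothesis indepX : forall B : I -> set R, (forall i, measurable (B i)) ->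
  P (\bigcap_(i in setT) X i @^-1` B i) = (\prod_i P (X i @^-1` B i))%E.

Let cylinders (i : I) : set (set T) :=
  [set A | exists2 B : I -> set R, (forall j, measurable (B j)) &
           A = \bigcap_(j in [set j | j != i]) X j @^-1` B j].

Let mpreX i (B : set R) : measurable B -> measurable (X i @^-1` B).
Proof. by move=> mB; rewrite -[X in measurable X]setTI; exact: mX. Qed.

Let measurable_cylinders i : cylinders i `<=` measurable.
Proof.
move=> _ [B mB ->]; apply: fin_bigcap_measurable; first exact: finite_finset.
by move=> j _; exact: mpreX.
Qed.

Let setI_closed_cylinders i : setI_closed (cylinders i).
Proof.
move=> _ _ [B mB ->] [C mC ->]; exists (fun j => B j `&` C j).
  by move=> j; exact: measurableI.
by rewrite -bigcapI; apply: eq_bigcapr => j _; rewrite preimage_setI.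
Qed.

(** For fixed [D] both sides are finite measures in [A]. They agree on the cylinders, which are
    closed under intersection, hence on the generated sigma-algebra. *)
Let cylinders_indep i (A : set T) (D : set R) : <<s cylinders i >> A ->
  measurable D -> P (A `&` X i @^-1` D) = (P A * normal_prob 0 1 D)%E.
Proof.
move=> sA mD.
have finD : P (X i @^-1` D) \is a fin_num by apply: fin_num_measure; exact: mpreX.
have q0 : 0 <= fine (P (X i @^-1` D)) by exact: fine_ge0.
pose m1 : {measure set T -> \bar R} := mrestr P (mpreX i mD).
pose m2 : {measure set T -> \bar R} := mscale (NngNum q0) P.
have -> : P (A `&` X i @^-1` D) = m1 A by [].
have -> : (P A * normal_prob 0 1 D = m2 A)%E.
  by rewrite muleC -(lawX i) // /m2 /= /mscale/= fineK.
apply: (g_sigma_algebra_measure_unique (cylinders i) _ (fun=> setT)) => //.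
- move=> _; exists (fun=> setT) => //.
  by apply/seteqP; split.
- by rewrite bigcup_const.
- move=> _ [B mB ->]; rewrite /m1 /m2 /= /mscale /mrestr /=.
  rewrite fineK//.
  pose C j := if j == i then D else B j.
  have mC j : measurable (C j) by rewrite /C; case: eqP.
  pose C' j := if j == i then setT else B j.
  have mC' j : measurable (C' j) by rewrite /C'; case: eqP.
  have -> : \bigcap_(j in [set j | j != i]) X j @^-1` B j `&` X i @^-1` D =
      \bigcap_(j in setT) X j @^-1` C j.
    apply/seteqP; split=> [t [tB tD] j _|t tC].
      by rewrite /C; case: eqP => [->//|/eqP ji]; exact: tB.
    split; last by have := tC i Logic.I; rewrite /C eqxx.
    by move=> j /negbTE ji; have := tC j Logic.I; rewrite /C ji.
  have -> : \bigcap_(j in [set j | j != i]) X j @^-1` B j =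
      \bigcap_(j in setT) X j @^-1` C' j.
    apply/seteqP; split=> [t tB j _|t tC].
      by rewrite /C'; case: eqP => [->//|/eqP ji]; exact: tB.
    by move=> j /negbTE ji; have := tC j Logic.I; rewrite /C' ji.
  rewrite !indepX// (bigD1 i)//= [in RHS](bigD1 i)//= {1}/C {1}/C' !eqxx.
  rewrite preimage_setT probability_setT mul1e; congr (_ * _)%E.
  by apply: eq_bigr => j /negbTE ji; rewrite /C /C' ji.
- by move=> _; rewrite /m1 /= /mrestr setTI ltey_eq finD.
Qed.

(** Given the other coordinates, coordinate [i] is still standard Gaussian. All later uses of
    independence go through this identity. *)
Lemma ge0_integral_resample (i : I) (f : (I -> R) -> \bar R) :
  measurable_in_coords f -> (forall w, (0 <= f w)%E) ->
  (\int[P]_t f (X^~ t) = \int[P]_t \int[normal_prob 0 1]_x f (upd (X^~ t) i x))%E.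
Proof.
move=> mf f0.
(* [T] itself, with the sigma-algebra of the coordinates other than [i]. *)
pose T1 := g_sigma_algebraType (cylinders i).
pose Y : T -> T1 := id.
have mT1 (A : set T1) : measurable A -> measurable (A : set T).
  apply: smallest_sub; last exact: measurable_cylinders.
  exact: sigma_algebra_measurable.
have mY : measurable_fun setT Y by move=> _ A mA; rewrite setTI; exact: mT1.
pose Ym := isMeasurableFun.Build _ _ _ _ _ mY.
pose Y' : {mfun T >-> T1} := HB.pack Y Ym.
have mXi : measurable_fun setT (X i : T -> measurableTypeR R) by exact: mX.
pose Xm := isMeasurableFun.Build _ _ _ _ _ mXi.
pose X' : {mfun T >-> measurableTypeR R} := HB.pack (X i : T -> measurableTypeR R) Xm.
have mXj j : j != i -> measurable_fun setT (X j : T1 -> R).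
  move=> ji _ A mA; rewrite setTI; apply: sub_sigma_algebra.
  exists (fun k => if k == j then A else setT).
    by move=> k; case: ifP.
  apply/seteqP; split=> [t tA k _|t /(_ j ji)].
    by case: eqP => [->|].
  by rewrite /= eqxx.
(* [g] takes coordinate [i] from the second factor, so it needs only the coordinates that are
   measurable for the smaller sigma-algebra of [T1]. *)
pose g (z : T1 * measurableTypeR R) := f (upd (X^~ z.1) i z.2).
rewrite -[RHS](@ge0_integral_indep_pair _ _ _ _ _ _ _ P (normal_prob 0 1) Y' X' g).
- by apply: eq_integral => t _; rewrite /g /= upd_id.
- by move=> A B mA mB; exact: cylinders_indep.
- apply: (mf _ _ (fun j (z : T1 * measurableTypeR R) => upd (X^~ z.1) i z.2 j)) => j.
  rewrite /upd; case: (eqVneq j i) => [_|ji]; first exact: measurable_snd.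
  exact: (measurableT_comp (mXj j ji) measurable_fst).
- by move=> z; exact: f0.
Qed.

End std_gaussian_family.

(** * Measurability of square roots, inverses and nonvanishing indicators *)

Lemma measurable_sqrt (d : measure_display) (T : measurableType d) (R : realType)
    (f : T -> R) :
  measurable_fun setT f -> measurable_fun setT (fun t => Num.sqrt (f t)).
Proof.
(* [Num.sqrt] is [0] at negative arguments, hence the truncation by [Num.max 0]. *)
move=> mf; have -> : (fun t => Num.sqrt (f t)) =
    (@powR R ^~ 2^-1) \o (fun t => Num.max 0 (f t)).
  apply/funext => t /=; rewrite powR12_sqrt ?le_max ?lexx//.
  by case: (leP 0 (f t)) => [//|/ltW /ler0_sqrtr ->]; rewrite sqrtr0.
apply: (@measurableT_comp _ _ _ _ _ _ (@powR R ^~ 2^-1)) => //.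
exact: measurable_maxr.
Qed.

Lemma measurable_inv_ge0 (d : measure_display) (T : measurableType d) (R : realType)
    (f : T -> R) : (forall t, 0 <= f t) ->
  measurable_fun setT f -> measurable_fun setT (fun t => (f t)^-1).
Proof.
move=> f0 mf; have -> : (fun t => (f t)^-1) = (@powR R ^~ (-1)) \o f.
  by apply/funext => t /=; rewrite powR_inv1.
exact: (@measurableT_comp _ _ _ _ _ _ (@powR R ^~ (-1))) mf.
Qed.

Lemma measurable_neq0 (d : measure_display) (T : measurableType d) (R : realType)
    (f : T -> R) :
  measurable_fun setT f -> measurable_fun setT (fun t => (f t != 0)%:R : R).
Proof.
move=> mf; have -> : (fun t => (f t != 0)%:R : R) = \1_(f @^-1` (~` [set 0])).
  apply/funext => t; rewrite indicE; congr (_%:R); congr nat_of_bool.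
  by apply/idP/idP => [/eqP ft|]; rewrite ?inE//= => /eqP.
apply: measurable_indic; rewrite -[X in measurable X]setTI; apply: mf => //.
exact: measurableC.
Qed.

(** * Integrating out Gaussian coordinates one at a time *)

Section coords.
Context {d : measure_display} {T : measurableType d} {R : realType}.
Context (P : probability T R) (I : finType) (X : I -> T -> R).
Hypothesis mX : forall i, measurable_fun setT (X i).
Hypothesis lawX : forall i (B : set R), measurable B ->
  P (X i @^-1` B) = normal_prob 0 1 B.
Hypothesis indepX : forall B : I -> set R, (forall i, measurable (B i)) ->
  P (\bigcap_(i in setT) X i @^-1` B i) = (\prod_i P (X i @^-1` B i))%E.

Lemma integral_prod_std_gaussian (h : R -> R) (c : R) (s : seq I) :
  measurable_fun setT h -> (forall x, 0 <= h x) ->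
  (\int[normal_prob 0 1]_x (h x)%:E = c%:E)%E -> uniq s ->
  (\int[P]_t (\prod_(i <- s) h (X i t))%:E = (c ^+ size s)%:E)%E.
Proof.
move=> mh h0 hc; have c0 : 0 <= c.
  by rewrite -lee_fin -hc; apply: integral_ge0 => x _; rewrite lee_fin.
have mprod (s' : seq I) :
    measurable_in_coords (fun w : I -> R => (\prod_(i <- s') h (w i))%:E).
  move=> d' S Y mY; apply/measurable_EFinP; apply: measurable_prod => i _.
  exact: measurableT_comp.
elim: s => [_|i s IH /andP[iNs us]].
  under eq_integral do rewrite big_nil.
  by rewrite integral_cst// [X in (_ * X)%E](@probability_setT _ _ _ P) mule1 expr0.
rewrite (@ge0_integral_resample _ _ _ P _ X mX lawX indepX i
  (fun w => (\prod_(i <- (i :: s)) h (w i))%:E)); last 2 first.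
- exact: mprod.
- by move=> w; rewrite lee_fin; apply: prodr_ge0.
transitivity (\int[P]_t (c%:E * (\prod_(j <- s) h (X j t))%:E))%E.
  apply: eq_integral => t _.
  have E x : (\prod_(j <- i :: s) h (upd (X^~ t) i x j))%:E =
      ((\prod_(j <- s) h (X j t))%:E * (h x)%:E)%E.
    rewrite big_cons {1}/upd eqxx -EFinM mulrC; congr ((_ * _)%:E).
    apply: eq_big_seq => j js; rewrite /upd; case: eqP => // ji.
    by rewrite -ji js in iNs.
  under eq_integral do rewrite E.
  rewrite ge0_integralZl//; first last.
  - by rewrite lee_fin; apply: prodr_ge0.
  - by move=> x _; rewrite lee_fin.
  - exact/measurable_EFinP.
  - by rewrite hc muleC.
rewrite ge0_integralZl//; first last.
- by move=> t _; rewrite lee_fin; apply: prodr_ge0.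
- exact: mprod.
by rewrite IH// -EFinM exprS.
Qed.

Definition indep_of_coords (U : Type) (s : seq I) (f : (I -> R) -> U) :=
  forall i w x, i \in s -> f (upd w i x) = f w.

(* Integrating one coordinate of a Gaussian exponential of a linear form adds
   the square of its coefficient to the variance parameter [tau]. *)
Lemma integral_gauss_linear_form (s : seq I) (a : I -> (I -> R) -> R)
    (phi tau : (I -> R) -> R) :
  uniq s ->
  (forall i, measurable_in_coords (a i)) ->
  measurable_in_coords phi -> measurable_in_coords tau ->
  (forall i, indep_of_coords s (a i)) ->
  indep_of_coords s phi -> indep_of_coords s tau ->
  (forall w, 0 <= phi w) -> (forall w, 0 <= tau w) ->
  (forall w, phi w != 0 -> 0 < tau w) ->
  (\int[P]_t (phi (X^~ t) * expR (- (\sum_(i <- s) a i (X^~ t) * X i t) ^+ 2 /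
                (2 * tau (X^~ t))))%:E =
   \int[P]_t (phi (X^~ t) * Num.sqrt (tau (X^~ t) /
                (tau (X^~ t) + \sum_(i <- s) a i (X^~ t) ^+ 2)))%:E)%E.
Proof.
move=> us ma; elim: s us phi tau => [_|i s IH /andP[iNs us]] phi tau mphi mtau
  ia iphi itau phi0 tau0 phitau.
  apply: eq_integral => t _; rewrite !big_nil expr0n oppr0 mul0r expR0 addr0.
  have [->|/phitau t0] := eqVneq (phi (X^~ t)) 0; first by rewrite !mul0r.
  by rewrite divff ?sqrtr1// gt_eqF.
have sub U (f : (I -> R) -> U) : indep_of_coords (i :: s) f -> indep_of_coords s f.
  by move=> fi j w x js; apply: fi; rewrite inE js orbT.
have mS (s' : seq I) (d' : measure_display) (S : measurableType d') (Y : I -> S -> R) :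
    (forall j, measurable_fun setT (Y j)) ->
    measurable_fun setT (fun t => \sum_(j <- s') a j (Y^~ t) * Y j t).
  move=> mY; apply: measurable_sum => j.
  by apply: measurable_funM => //; exact: ma.
(* After integration over coordinate [i] the variance parameter is [tau'] and the prefactor gains
   [sqrt (tau / tau')]; these square roots telescope along [s]. Where [phi] vanishes, so do both
   integrands, and elsewhere [tau] is positive. *)
pose tau' w := tau w + a i w ^+ 2.
pose phi' w := phi w * Num.sqrt (tau w / tau' w).
have tau'0 w : 0 <= tau' w by rewrite addr_ge0// sqr_ge0.
have mtau' : measurable_in_coords tau'.
  move=> d' S Y mY; apply: measurable_funD; first exact: mtau.
  by apply: measurable_funX; exact: ma.
rewrite (@ge0_integral_resample _ _ _ P _ X mX lawX indepX i
  (fun w => (phi w * expR (- (\sum_(j <- i :: s) a j w * w j) ^+ 2 /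
     (2 * tau w)))%:E)); last 2 first.
- move=> d' S Y mY; apply/measurable_EFinP; apply: measurable_funM; first exact: mphi.
  apply: measurableT_comp => //; apply: measurable_funM.
    by apply: measurableT_comp => //; apply: measurable_funX; exact: mS.
  apply: measurable_inv_ge0; first by move=> t; rewrite mulr_ge0.
  by apply: measurable_funM => //; exact: mtau.
- by move=> w; rewrite lee_fin mulr_ge0 ?expR_ge0.
transitivity (\int[P]_t (phi' (X^~ t) * expR (- (\sum_(j <- s) a j (X^~ t) * X j t) ^+ 2 /
                (2 * tau' (X^~ t))))%:E)%E.
  apply: eq_integral => t _; set w := X^~ t.
  have ii : i \in i :: s by rewrite inE eqxx.
  have E x : (phi (upd w i x) * expR (- (\sum_(j <- i :: s) a j (upd w i x) * upd w i x j) ^+ 2 /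
     (2 * tau (upd w i x))))%:E = ((phi w)%:E *
      (expR (- (a i w * x + \sum_(j <- s) a j w * w j) ^+ 2 / (2 * tau w)))%:E)%E.
    rewrite iphi// itau// -EFinM big_cons ia// {1}/upd eqxx.
    rewrite (eq_big_seq (fun j => a j w * w j))// => j js.
    rewrite ia// /upd; case: eqP => // ji.
    by rewrite -ji js in iNs.
  under eq_integral do rewrite E.
  rewrite ge0_integralZl//; first last.
  - by rewrite lee_fin.
  - apply/measurable_EFinP; apply: measurableT_comp => //; apply: measurable_funM => //.
    apply: measurableT_comp => //; apply: measurable_funX.
    by apply: measurable_funD => //; exact: measurable_funM.
  have [p0|/phitau t0] := eqVneq (phi w) 0; first by rewrite /phi' p0 !mul0r mul0e.
  by rewrite integral_normal_prob_gauss// -EFinM mulrA.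
rewrite IH//.
- apply: eq_integral => t _; congr (_%:E); rewrite /phi' /tau' -mulrA big_cons.
  have [->|/phitau t0] := eqVneq (phi (X^~ t)) 0; first by rewrite !mul0r.
  have t'0 : tau (X^~ t) + a i (X^~ t) ^+ 2 != 0.
    by rewrite gt_eqF// ltr_pwDl ?sqr_ge0.
  congr (_ * _); rewrite -sqrtrM; last exact: divr_ge0 (tau0 _) (tau'0 _).
  by rewrite mulrA divfK// addrA.
- move=> d' S Y mY; apply: measurable_funM; first exact: mphi.
  apply: measurable_sqrt; apply: measurable_funM; first exact: mtau.
  by apply: measurable_inv_ge0 => //; exact: mtau'.
- by move=> j; apply: sub.
- by move=> j w x js; rewrite /phi' /tau' (sub _ _ iphi)// (sub _ _ itau)// (sub _ _ (ia i)).
- by move=> j w x js; rewrite /tau' (sub _ _ itau)// (sub _ _ (ia i)).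
- by move=> w; rewrite mulr_ge0 ?sqrtr_ge0.
- move=> w; rewrite mulf_eq0 negb_or => /andP[/phitau t0 _].
  by rewrite ltr_pwDl ?sqr_ge0.
Qed.

End coords.

(** * Determinants and cofactors of a compressed Gaussian matrix *)

Lemma measurable_det (d : measure_display) (T : measurableType d) (R : realType)
    (n : nat) (A : T -> 'M[R]_n) :
  (forall i j, measurable_fun setT (fun t => A t i j)) ->
  measurable_fun setT (fun t => \det (A t)).
Proof.
move=> mA; apply: measurable_sum => s; apply: measurable_funM => //.
by apply: measurable_prod => i _.
Qed.

Lemma sum_sqr_mulmx_scalar (R : comPzRingType) (r m : nat) (V : 'M[R]_(r, m)) (v : R)
    (u : 'I_r -> R) : V *m V^T = v%:M ->
  \sum_i (\sum_j V j i * u j) ^+ 2 = v * \sum_j u j ^+ 2.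
Proof.
move=> VV; pose ur := \row_j u j.
have -> : \sum_i (\sum_j V j i * u j) ^+ 2 = ((ur *m V) *m (ur *m V)^T) 0 0.
  rewrite mxE; apply: eq_bigr => i _; rewrite [(_^T) _ _]mxE -expr2 mxE; congr (_ ^+ 2).
  by apply: eq_bigr => j _; rewrite mxE mulrC.
rewrite trmx_mul -mulmxA (mulmxA V) VV mulmxA mul_mx_scalar -scalemxAl mxE.
congr (_ * _); rewrite mxE; apply: eq_bigr => j _.
by rewrite !mxE expr2.
Qed.

Section random_matrix.
Context {d : measure_display} {T : measurableType d} {R : realType}.
Context (P : probability T R) (m k : nat) (X : 'I_m * 'I_k -> T -> R).
Hypothesis mX : forall i, measurable_fun setT (X i).
Hypothesis lawX : forall i (B : set R), measurable B ->
  P (X i @^-1` B) = normal_prob 0 1 B.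
Hypothesis indepX : forall B : 'I_m * 'I_k -> set R, (forall i, measurable (B i)) ->
  P (\bigcap_(i in setT) X i @^-1` B i) = (\prod_i P (X i @^-1` B i))%E.

(** The column selection [g] is left general so that an induction on [r] can delete a row of [V]
    together with a column of the Gaussian matrix. *)
Definition compressed (r : nat) (V : 'M[R]_(r, m)) (g : 'I_r -> 'I_k)
  (w : 'I_m * 'I_k -> R) : 'M[R]_r := V *m \matrix_(i, c) w (i, g c).

(** This is the squared norm of row [c] of the adjugate; divided by the squared determinant it is
    that of row [c] of the inverse. *)
Definition cofactor_col_sqr (r : nat) (A : 'M[R]_r) (c : 'I_r) : R :=
  \sum_j cofactor A j c ^+ 2.

Lemma measurable_compressed r (V : 'M[R]_(r, m)) g i j :
  measurable_in_coords (fun w => compressed V g w i j).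
Proof.
move=> d' S Y mY; have -> : (fun s => compressed V g (Y^~ s) i j) =
    (fun s => \sum_l V i l * Y (l, g j) s).
  by apply/funext => s; rewrite mxE; apply: eq_bigr => l _; rewrite mxE.
by apply: measurable_sum => l; exact: measurable_funM.
Qed.

Lemma measurable_det_compressed r (V : 'M[R]_(r, m)) g :
  measurable_in_coords (fun w => \det (compressed V g w)).
Proof.
move=> d' S Y mY; apply: measurable_det => i j; exact: measurable_compressed.
Qed.

Lemma measurable_cofactor_compressed r (V : 'M[R]_(r, m)) g i j :
  measurable_in_coords (fun w => cofactor (compressed V g w) i j).
Proof.
move=> d' S Y mY; apply: measurable_funM => //; apply: measurable_det => a b.
have -> : (fun t => row' i (col' j (compressed V g (Y^~ t))) a b) =
    (fun t => compressed V g (Y^~ t) (lift i a) (lift j b)).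
  by apply/funext => t; rewrite !mxE.
exact: measurable_compressed.
Qed.

Lemma measurable_cofactor_col_sqr r (V : 'M[R]_(r, m)) g c :
  measurable_in_coords (fun w => cofactor_col_sqr (compressed V g w) c).
Proof.
move=> d' S Y mY; apply: measurable_sum => j; apply: measurable_funX.
exact: measurable_cofactor_compressed.
Qed.

Lemma cofactor_col_sqr_ge0 r (A : 'M[R]_r) c : 0 <= cofactor_col_sqr A c.
Proof. by apply: sumr_ge0 => j _; rewrite sqr_ge0. Qed.

(** These cofactors delete column [c], and by injectivity of [g] the entry [(i, g c)] influences no
    other column. *)
Lemma cofactor_compressed_upd r (V : 'M[R]_(r, m)) (g : 'I_r -> 'I_k) w i c j x :
  injective g ->
  cofactor (compressed V g (upd w (i, g c) x)) j c = cofactor (compressed V g w) j c.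
Proof.
move=> ginj; congr (_ * \det _); apply/matrixP => a b; rewrite !mxE.
apply: eq_bigr => l _; rewrite !mxE /upd xpair_eqE (inj_eq ginj).
by rewrite (eq_sym (lift _ _)) (negbTE (neq_lift _ _)) andbF.
Qed.

(** Expanding along column [c] makes the determinant a linear form in fresh Gaussians, with squared
    coefficients summing to [v * N] for [N] the cofactor sum. Integrating with parameter [tau * N]
    leaves [sqrt (tau / (tau + v))]: the factor [N] cancels. The indicator keeps [tau * N]
    positive. *)
Lemma gauss_small_ball (r : nat) (V : 'M[R]_(r, m)) (g : 'I_r -> 'I_k) (c : 'I_r)
    (v tau : R) : injective g -> V *m V^T = v%:M -> 0 < v -> 0 < tau ->
  (\int[P]_t ((cofactor_col_sqr (compressed V g (X^~ t)) c != 0)%:R *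
     expR (- (\det (compressed V g (X^~ t))) ^+ 2 /
       (2 * (tau * cofactor_col_sqr (compressed V g (X^~ t)) c))))%:E
   <= (Num.sqrt (tau / v))%:E)%E.
Proof.
move=> ginj VV v0 tau0.
pose N w := cofactor_col_sqr (compressed V g w) c.
pose phi w : R := (N w != 0)%:R.
pose a (p : 'I_m * 'I_k) w := \sum_j V j p.1 * cofactor (compressed V g w) j c.
pose s := [seq (i, g c) | i <- enum 'I_m].
have us : uniq s by rewrite map_inj_uniq ?enum_uniq// => x y [].
have Ni : indep_of_coords s N.
  move=> _ w x /mapP[i _ ->]; apply: eq_bigr => j _.
  by rewrite cofactor_compressed_upd.
have N0 w : 0 <= N w by exact: cofactor_col_sqr_ge0.
have detE w : \det (compressed V g w) = \sum_(p <- s) a p w * w p.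
  rewrite big_map big_enum/= (expand_det_col _ c).
  under [RHS]eq_bigr do rewrite /a mulr_suml.
  rewrite exchange_big; apply: eq_bigr => j _.
  rewrite mxE mulr_suml; apply: eq_bigr => i _; rewrite mxE/=.
  by rewrite mulrAC.
have aE w : \sum_(p <- s) a p w ^+ 2 = v * N w.
  by rewrite big_map big_enum/= (sum_sqr_mulmx_scalar _ VV).
under eq_integral do rewrite detE.
rewrite (@integral_gauss_linear_form _ _ _ P _ X mX lawX indepX s a phi
  (fun w => tau * N w)) //; first last.
- move=> w; rewrite /phi pnatr_eq0 eqb0 negbK => Nw.
  by rewrite mulr_gt0// lt0r Nw N0.
- by move=> w; rewrite mulr_ge0// ltW.
- by move=> i w x si; rewrite Ni.
- by move=> i w x si; rewrite /phi Ni.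
- move=> p _ w x /mapP[i _ ->]; apply: eq_bigr => j _.
  by rewrite cofactor_compressed_upd.
- move=> d' S Y mY; apply: measurable_funM => //.
  exact: measurable_cofactor_col_sqr.
- move=> d' S Y mY; apply: measurable_neq0.
  exact: measurable_cofactor_col_sqr.
- move=> p d' S Y mY; apply: measurable_sum => j; apply: measurable_funM => //.
  exact: measurable_cofactor_compressed.
have le1 t : phi (X^~ t) * Num.sqrt (tau * N (X^~ t) /
    (tau * N (X^~ t) + \sum_(p <- s) a p (X^~ t) ^+ 2)) <= Num.sqrt (tau / v).
  rewrite aE /phi; case: eqP => [->|/eqP Nw]; first by rewrite mul0r sqrtr_ge0.
  have Np : 0 < N (X^~ t) by rewrite lt0r Nw N0.
  rewrite mul1r -mulrDl invfM mulrACA divff// mulr1.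
  by apply: ler_wsqrtr; rewrite ler_pM2l// lef_pV2 ?posrE ?addr_gt0// lerDr ltW.
apply: (@le_trans _ _ (\int[P]_t (Num.sqrt (tau / v))%:E)%E).
  apply: ge0_le_integral => //.
  - by move=> t _; rewrite lee_fin mulr_ge0 ?sqrtr_ge0 ?ler0n.
  - apply/measurable_EFinP; apply: measurable_funM.
      apply: measurable_neq0; exact: measurable_cofactor_col_sqr.
    apply: measurable_sqrt; apply: measurable_funM.
      by apply: measurable_funM => //; exact: measurable_cofactor_col_sqr.
    apply: measurable_inv_ge0.
      by move=> t; rewrite aE -mulrDl mulr_ge0 ?addr_ge0 ?(ltW v0) ?(ltW tau0) ?N0.
    under eq_fun do rewrite aE.
    by apply: measurable_funD; apply: measurable_funM => //;
      exact: measurable_cofactor_col_sqr.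
  - by move=> t _; rewrite lee_fin.
by rewrite integral_cst// [X in (_ * X)%E](@probability_setT _ _ _ P) mule1.
Qed.

(** A vanishing determinant with some nonzero cofactor in the last column has probability zero by
    the small-ball bound as [tau] tends to [0]. If all those cofactors vanish, the corner one does,
    and it is a compressed determinant of size one less. *)
Lemma det_compressed_eq0_null (r : nat) (V : 'M[R]_(r, m)) (g : 'I_r -> 'I_k) (v : R) :
  injective g -> V *m V^T = v%:M -> 0 < v ->
  P [set t | \det (compressed V g (X^~ t)) = 0] = 0%E.
Proof.
elim: r V g => [|r IH] V g ginj VV v0.
  rewrite [X in P X](_ : _ = set0) ?measure0//.
  by apply/seteqP; split => // t /=; rewrite det_mx00 => /eqP; rewrite oner_eq0.
pose A t := compressed V g (X^~ t).
have mzero (f : T -> R) : measurable_fun setT f -> measurable [set t | f t = 0].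
  move=> mf; rewrite (_ : [set t | _] = f @^-1` [set 0])//.
  by rewrite -[X in measurable X]setTI; exact: mf.
have mdet : measurable [set t | \det (A t) = 0].
  by apply: mzero; exact: measurable_det_compressed.
have mN : measurable [set t | cofactor_col_sqr (A t) ord_max = 0].
  by apply: mzero; exact: measurable_cofactor_col_sqr.
have mC : measurable [set t | cofactor (A t) ord_max ord_max = 0].
  by apply: mzero; exact: measurable_cofactor_compressed.
have C0 : P [set t | cofactor (A t) ord_max ord_max = 0] = 0%E.
  rewrite -(IH (row' ord_max V) (g \o lift ord_max))//.
  - congr (P _); apply/seteqP; split=> t /=; rewrite /cofactor.
      move=> /eqP; rewrite mulf_eq0 signr_eq0/= => /eqP.
      by move=> <-; congr (\det _); apply/matrixP => i j; rewrite !mxE;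
        apply: eq_bigr => l _; rewrite !mxE.
    move=> d0; apply/eqP; rewrite mulf_eq0 signr_eq0/=; apply/eqP.
    by rewrite -d0; congr (\det _); apply/matrixP => i j; rewrite !mxE;
      apply: eq_bigr => l _; rewrite !mxE.
  - by move=> i j /ginj /lift_inj.
  - apply/matrixP => i j; have /matrixP/(_ (lift ord_max i) (lift ord_max j)) := VV.
    rewrite !mxE (inj_eq lift_inj) => <-; apply: eq_bigr => l _.
    by rewrite !mxE.
have D0 : P ([set t | \det (A t) = 0] `\` [set t | cofactor_col_sqr (A t) ord_max = 0]) = 0%E.
  set D := _ `\` _; have mD : measurable D by exact: measurableD.
  apply/eqP; rewrite eq_le measure_ge0 andbT; apply/lee_addgt0Pr => e e0.
  (* This [tau] turns the small-ball bound into [e]; on [D] the Gaussian exponential equals [1]. *)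
  rewrite add0e; pose tau := v * e ^+ 2.
  have tau0 : 0 < tau by rewrite mulr_gt0// exprn_gt0.
  have -> : e = Num.sqrt (tau / v).
    by rewrite /tau mulrAC divff ?gt_eqF// mul1r sqrtr_sqr gtr0_norm.
  apply: le_trans (gauss_small_ball ord_max ginj VV v0 tau0).
  rewrite -[D]setIT -integral_indic//; apply: ge0_le_integral => //.
  - exact/measurable_EFinP/measurable_indic.
  - apply/measurable_EFinP; apply: measurable_funM.
      by apply: measurable_neq0; exact: measurable_cofactor_col_sqr.
    apply: measurableT_comp => //; apply: measurable_funM.
      apply: measurableT_comp => //; apply: measurable_funX.
      exact: measurable_det_compressed.
    apply: measurable_inv_ge0.
      by move=> t; rewrite mulr_ge0// mulr_ge0 ?(ltW tau0) ?cofactor_col_sqr_ge0.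
    do 2 apply: measurable_funM => //.
    exact: measurable_cofactor_col_sqr.
  - move=> t _; rewrite lee_fin indicE; case: (boolP (t \in D)); last first.
      by rewrite mulr_ge0 ?ler0n ?expR_ge0.
    rewrite inE /D /A /= => -[-> /eqP ->].
    by rewrite expr0n oppr0 mul0r expR0 mulr1.
apply/eqP; rewrite eq_le measure_ge0 andbT.
apply: (@le_trans _ _ (P ([set t | cofactor (A t) ord_max ord_max = 0] `|`
   ([set t | \det (A t) = 0] `\` [set t | cofactor_col_sqr (A t) ord_max = 0])))).
  apply: le_measure; rewrite ?inE//; first by apply: measurableU => //; exact: measurableD.
  move=> t /= dt; have [N0|N0] := eqVneq (cofactor_col_sqr (A t) ord_max) 0; last first.
    by right; split => //; apply/eqP.
  left; apply/eqP; rewrite -sqrf_eq0; apply/eqP; move/eqP: N0.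
  by rewrite psumr_eq0// => [/allP/(_ ord_max)|j _]; rewrite ?sqr_ge0// mem_index_enum => /(_ isT)/eqP.
apply: (le_trans (measureU2 _ _ _)) => //; first exact: measurableD.
rewrite -[X in (_ <= X)%E]adde0; apply: leeD; rewrite le_eqVlt; apply/orP; left.
  exact/eqP/C0.
exact/eqP/D0.
Qed.

End random_matrix.

(** * Dominating [Num.min 1 y^-1] by Gaussian exponentials *)

Lemma expR_ge_pow_1D (R : realType) (x : R) (n : nat) : -1 <= x / n%:R -> (0 < n)%N ->
  (1 + x / n%:R) ^+ n <= expR x.
Proof.
move=> xn n0; have -> : expR x = expR (x / n%:R) ^+ n.
  by rewrite -expRM_natr mulfVK// pnatr_eq0 -lt0n.
by apply: lerXn2r; rewrite ?nnegrE ?expR_ge0 ?expR_ge1Dx// -lerBlDl sub0r.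
Qed.

Lemma expR_three_halves_ge4 (R : realType) : 4 <= expR (3 / 2) :> R.
Proof.
apply: le_trans (@expR_ge_pow_1D R (3 / 2) 12 _ _) => //; last by lra.
by rewrite !exprS expr0; lra.
Qed.

(** The constant gives equality with [y^-1] at [y = 4]. On [[1, 4]] the function
    [y * expR (- y / 2)] rises and then falls, so the endpoints decide, and [y = 1] needs
    [4 <= expR (3 / 2)]. *)
Lemma expR_half_window (R : realType) (y : R) : 0 < y -> y <= 4 ->
  Num.min 1 y^-1 <= expR 2 / 4 * expR (- y / 2).
Proof.
move=> y0 y4; rewrite mulrAC -expRD.
have e32 := expR_three_halves_ge4 R.
have [y1|y1] := leP y 1.
  rewrite ge_min; apply/orP; left; rewrite ler_pdivlMr// mul1r.
  by apply: (le_trans e32); rewrite ler_expR; lra.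
rewrite ge_min; apply/orP; right; rewrite ler_pdivlMr// mulrC ler_pdivrMr//.
(* In either range [1 + x <= expR x] reduces the claim to a factored quadratic:
   [(y - 1) * (2 - y) >= 0] up to [2], and [(y - 2) * (4 - y) >= 0] beyond. *)
have [y2|y2] := leP y 2.
  have -> : 2 + - y / 2 = 3 / 2 + (1 - y) / 2 by lra.
  have e1 : 1 + (1 - y) / 2 <= expR ((1 - y) / 2) by exact: expR_ge1Dx.
  rewrite expRD.
  have : 4 * (1 + (1 - y) / 2) <= expR (3 / 2) * expR ((1 - y) / 2).
    by apply: ler_pM => //; lra.
  by move=> h; nra.
have := @expR_ge1Dx R (2 + - y / 2); nra.
Qed.

(* The expectation of each exponential is controlled by [gauss_small_ball]; the
   mixture replaces [1/y], which is not integrable against a Gaussian. *)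
Lemma gauss_mixture_ge_min (R : realType) (N : nat) (y : R) : 0 < y ->
  Num.min 1 y^-1 <=
  (4^-1) ^+ N + \sum_(n < N) (expR 2 / 4 * (4^-1) ^+ n) * expR (- y / (2 * 4 ^+ n)).
Proof.
elim: N y => [|N IH] y y0.
  by rewrite big_ord0 addr0 expr0 ge_min lexx.
rewrite big_ord_recl expr0 !mulr1.
have [y4|y4] := leP y 4.
  rewrite addrCA; apply: (le_trans (expR_half_window y0 y4)).
  rewrite lerDl addr_ge0 ?exprn_ge0//; apply: sumr_ge0 => n _.
  by rewrite !mulr_ge0 ?expR_ge0 ?exprn_ge0.
rewrite addrCA; apply: ler_wpDl; first by rewrite mulr_ge0 ?expR_ge0// mulr_ge0 ?expR_ge0.
rewrite ge_min; apply/orP; right.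
(* Rescaling the window: the bound at [y / 4], divided by [4], is the required mixture with its
   terms shifted by one. *)
have := IH (y / 4); rewrite divr_gt0// => /(_ isT).
have -> : Num.min 1 (y / 4)^-1 = 4 * y^-1.
  by rewrite invf_div; apply/min_idPr; rewrite ler_pdivrMr// mul1r ltW.
rewrite -ler_pdivlMl// => /le_trans; apply; rewrite mulrDr -exprS lerD2l mulr_sumr.
apply: ler_sum => n _; rewrite lift0 exprS [in leLHS]mulrA.
rewrite le_eqVlt; apply/orP; left; apply/eqP; congr (_ * expR _); first by ring.
by rewrite exprS; field; rewrite expf_neq0.
Qed.

(** * Tail bounds for the row norms and for the inverse *)

Lemma measurable_set_lt (d : measure_display) (T : measurableType d) (R : realType)
    (f g : T -> R) : measurable_fun setT f -> measurable_fun setT g ->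
  measurable [set t | f t < g t].
Proof.
move=> mf mg; rewrite -[X in measurable X]setTI.
exact: (measurable_fun_ltr mf mg measurableT (I : measurable [set true])).
Qed.

Lemma measurable_set_le (d : measure_display) (T : measurableType d) (R : realType)
    (f g : T -> R) : measurable_fun setT f -> measurable_fun setT g ->
  measurable [set t | f t <= g t].
Proof.
move=> mf mg; rewrite -[X in measurable X]setTI.
exact: (measurable_fun_ler mf mg measurableT (I : measurable [set true])).
Qed.

Lemma sum_half_pow (R : numFieldType) (n : nat) :
  \sum_(l < n) (2^-1) ^+ l = 2 - 2 * (2^-1) ^+ n :> R.
Proof.
elim: n => [|n IH]; first by rewrite big_ord0 expr0 mulr1 subrr.
by rewrite big_ord_recr/= IH exprS; field.
Qed.

Section union_bounds.
Context {d : measure_display} {T : measurableType d} {R : realType}.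
Context (P : probability T R).

(** Markov's inequality for a weighted sum: the indicator of [D] is dominated pointwise, and the
    domination is integrated term by term. *)
Lemma probability_le_sum (J : finType) (D : set T) (c0 : R) (w b : J -> R)
    (h : J -> T -> R) :
  measurable D -> 0 <= c0 -> (forall j, 0 <= w j) ->
  (forall j t, 0 <= h j t) -> (forall j, measurable_fun setT (h j)) ->
  (forall j, (\int[P]_t (h j t)%:E <= (b j)%:E)%E) ->
  (forall t, D t -> 1 <= c0 + \sum_j w j * h j t) ->
  (P D <= (c0 + \sum_j w j * b j)%:E)%E.
Proof.
move=> mD c00 w0 h0 mh hb Dh.
have msum : measurable_fun setT (fun t => (\sum_j (w j)%:E * (h j t)%:E)%E).
  apply: emeasurable_sum => j; apply: emeasurable_funM => //.
  exact/measurable_EFinP.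
have sum0 t : (0 <= \sum_j (w j)%:E * (h j t)%:E)%E.
  by apply: sume_ge0 => j _; rewrite mule_ge0 ?lee_fin.
have -> : P D = (\int[P]_t (\1_D t)%:E)%E by rewrite integral_indic// setIT.
apply: (@le_trans _ _ (\int[P]_t (c0%:E + \sum_j (w j)%:E * (h j t)%:E))%E).
  apply: ge0_le_integral => //.
  - exact/measurable_EFinP/measurable_indic.
  - exact: emeasurable_funD.
  - move=> t _; rewrite indicE; case: (boolP (t \in D)) => [|_].
      rewrite inE => /Dh h1; under eq_bigr do rewrite -EFinM.
      by rewrite sumEFin -EFinD lee_fin.
    by rewrite adde_ge0.
rewrite ge0_integralD// integral_cst// [X in (_ * X)%E](@probability_setT _ _ _ P) mule1.
rewrite EFinD leeD2l// -sumEFin ge0_integral_sum//; last 2 first.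
- by move=> j; apply: emeasurable_funM => //; exact/measurable_EFinP.
- by move=> j t _; rewrite mule_ge0 ?lee_fin.
apply: lee_sum => j _; rewrite ge0_integralZl//; first last.
- by rewrite lee_fin.
- by move=> t _; rewrite lee_fin.
- exact/measurable_EFinP.
by rewrite EFinM; apply: lee_wpmul2l; rewrite ?lee_fin.
Qed.

Context (m k : nat) (X : 'I_m * 'I_k -> T -> R).
Hypothesis mX : forall i, measurable_fun setT (X i).
Hypothesis lawX : forall i (B : set R), measurable B ->
  P (X i @^-1` B) = normal_prob 0 1 B.
Hypothesis indepX : forall B : 'I_m * 'I_k -> set R, (forall i, measurable (B i)) ->
  P (\bigcap_(i in setT) X i @^-1` B i) = (\prod_i P (X i @^-1` B i))%E.

Lemma measurable_row_sqr i : measurable_fun setT (fun t => \sum_c X (i, c) t ^+ 2).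
Proof. by apply: measurable_sum => c; exact: measurable_funX. Qed.

(** Chernoff bound with parameter [1/4] in each row, where every entry contributes [sqrt 2], and a
    union bound over the rows. *)
Lemma large_row_bound (a : R) :
  (P [set t | exists i : 'I_m, (a < \sum_c X (i, c) t ^+ 2)%R] <=
   (m%:R * (expR (- a / 4) * Num.sqrt 2 ^+ k))%:E)%E.
Proof.
pose h (i : 'I_m) t := \prod_(p <- [seq (i, c) | c <- enum 'I_k]) expR (X p t ^+ 2 / 4).
have hE i t : h i t = expR ((\sum_c X (i, c) t ^+ 2) / 4).
  by rewrite /h big_map big_enum/= -expR_sum mulr_suml.
have -> : m%:R * (expR (- a / 4) * Num.sqrt 2 ^+ k) =
    0 + \sum_(i < m) expR (- a / 4) * Num.sqrt 2 ^+ k :> R.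
  by rewrite add0r sumr_const card_ord mulr_natl.
apply: (@probability_le_sum _ _ _ (fun=> _) (fun=> _) h) => //.
- pose B (i : 'I_m) : set T := [set t | a < \sum_c X (i, c) t ^+ 2].
  rewrite [X in measurable X](_ : _ = \bigcup_(i in setT) B i).
    apply: fin_bigcup_measurable; first exact: finite_finset.
    by move=> i _; apply: measurable_set_lt => //; exact: measurable_row_sqr.
  by apply/seteqP; split=> t /= [i]; [exists i|move=> _ ai; exists i].
- by move=> i t; rewrite hE expR_ge0.
- move=> i; rewrite (_ : h i = fun t => expR ((\sum_c X (i, c) t ^+ 2) / 4)).
    apply: measurableT_comp => //; apply: measurable_funM => //.
    exact: measurable_row_sqr.
  by apply/funext => t; rewrite hE.
- move=> i; rewrite (@integral_prod_std_gaussian _ _ _ P _ X mX lawX indepX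
    (fun x => expR (x ^+ 2 / 4)) (Num.sqrt 2)).
  + by rewrite size_map size_enum_ord.
  + by apply: measurableT_comp => //; apply: measurable_funM.
  + by move=> x; rewrite expR_ge0.
  + exact: integral_normal_prob_expR_sqr.
  + by rewrite map_inj_uniq ?enum_uniq// => x y [].
- move=> t [i ai]; rewrite add0r (bigD1 i)//= hE -expRD.
  apply: ler_wpDr; first by apply: sumr_ge0 => j _; rewrite hE mulr_ge0 ?expR_ge0.
  by rewrite -[leLHS]expR0 ler_expR; lra.
Qed.

(** With the determinant multiplied out, the event also contains the singular matrices, which form a
    null set. Elsewhere the mixture bound applies to [y = S * det ^ 2 / N] for each column. *)
Lemma large_inverse_bound (V : 'M[R]_(k, m)) (v S : R) :
  V *m V^T = v%:M -> 0 < v -> 0 < S ->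
  (P [set t | (S * \det (compressed V id (X^~ t)) ^+ 2 <=
              \sum_c cofactor_col_sqr (compressed V id (X^~ t)) c)%R] <=
   (k%:R * (expR 2 / 2) / Num.sqrt (S * v))%:E)%E.
Proof.
move=> VV v0 S0; set D := [set t | _].
pose A t := compressed V id (X^~ t).
pose N c t := cofactor_col_sqr (A t) c.
have mdet : measurable_fun setT (fun t => \det (A t)).
  exact: measurable_det_compressed.
have mN c : measurable_fun setT (N c) by exact: measurable_cofactor_col_sqr.
have N0 c t : 0 <= N c t by exact: cofactor_col_sqr_ge0.
pose Z := [set t | \det (A t) = 0].
have mZ : measurable Z.
  rewrite (_ : Z = (fun t => \det (A t)) @^-1` [set 0])//.
  by rewrite -[X in measurable X]setTI; exact: mdet.
have mD : measurable D.
  apply: measurable_set_le; last exact: measurable_sum.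
  by apply: measurable_funM => //; exact: measurable_funX.
have PD : (P D <= P (D `\` Z))%E.
  apply: (@le_trans _ _ (P ((D `\` Z) `|` Z))).
    apply: le_measure; rewrite ?inE//.
      by apply: measurableU => //; exact: measurableD.
    by move=> t Dt; have [Zt|Zt] := pselect (Z t); [right|left].
  apply: (le_trans (measureU2 _ _ _)) => //; first exact: measurableD.
  have Z0 := det_compressed_eq0_null mX lawX indepX (@inj_id _) VV v0.
  rewrite -[X in (_ <= X)%E]adde0; apply: leeD => //.
  by rewrite le_eqVlt; apply/orP; left; exact/eqP/Z0.
apply: (le_trans PD); apply/lee_addgt0Pr => e e0.
(* Enough mixture terms that the remainders [4 ^ -n] of all [k] columns total at most [e]. *)
pose n := Num.bound (k%:R / e).
have ne : k%:R * (4^-1) ^+ n <= e.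
  rewrite exprVn ler_pdivrMr ?exprn_gt0// mulrC -ler_pdivrMr//.
  apply: (@le_trans _ _ n%:R).
    by apply/ltW/archi_boundP; rewrite divr_ge0 ?ler0n ?(ltW e0).
  by rewrite -natrX ler_nat ltnW// ltn_expl.
rewrite -EFinD addrC.
(* The variance parameter [4 ^+ j.2 / S] makes the exponent equal to [- y / (2 * 4 ^+ j.2)], a term
   of the mixture. *)
pose h (j : 'I_k * 'I_n) t := (N j.1 t != 0)%:R *
   expR (- (\det (A t)) ^+ 2 / (2 * (4 ^+ j.2 / S * N j.1 t))).
pose w (j : 'I_k * 'I_n) : R := expR 2 / 4 * (4^-1) ^+ j.2.
pose b (j : 'I_k * 'I_n) : R := Num.sqrt (4 ^+ j.2 / S / v).
apply: (@le_trans _ _ (k%:R * (4^-1) ^+ n + \sum_j w j * b j)%:E); last first.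
  rewrite lee_fin; apply: lerD => //.
  rewrite -(pair_bigA _ (fun c l => w (c, l) * b (c, l)))/=.
  have -> : k%:R * (expR 2 / 2) / Num.sqrt (S * v) =
      \sum_(c < k) (expR 2 / 2 / Num.sqrt (S * v)) :> R.
    by rewrite sumr_const card_ord -[RHS]mulr_natl -!mulrA.
  apply: ler_sum => c _.
  (* Weight [4 ^ -l] times bound [2 ^ l / sqrt (S * v)] is geometric of ratio [1/2]; its sum below
     [2] turns [expR 2 / 4] into [expR 2 / 2]. *)
  rewrite (eq_bigr (fun l : 'I_n => expR 2 / 4 / Num.sqrt (S * v) * (2^-1) ^+ l)).
    rewrite -mulr_sumr sum_half_pow.
    have -> : expR 2 / 2 / Num.sqrt (S * v) = expR 2 / 4 / Num.sqrt (S * v) * 2.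
      by field; rewrite gt_eqF// sqrtr_gt0 mulr_gt0.
    by rewrite ler_wpM2l ?divr_ge0 ?expR_ge0 ?sqrtr_ge0// gerBl mulr_ge0 ?exprn_ge0.
  move=> l _; rewrite /w /b /= -[4 ^+ l / S / v]mulrA -invfM.
  rewrite sqrtrM ?exprn_ge0// sqrtrV ?mulr_ge0 ?ltW//.
  have -> : 4 ^+ l = (2 ^+ l) ^+ 2 :> R by rewrite exprAC; congr (_ ^+ _); ring.
  rewrite sqrtr_sqr ger0_norm ?exprn_ge0//.
  have -> : (4^-1) ^+ l = (2^-1) ^+ l * (2^-1) ^+ l :> R.
    by rewrite -exprMn; congr (_ ^+ _); field.
  by rewrite !exprVn; field; rewrite expf_neq0//= gt_eqF// sqrtr_gt0 mulr_gt0.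
apply: (@probability_le_sum _ _ _ w b h).
- exact: measurableD.
- by rewrite mulr_ge0 ?exprn_ge0.
- by move=> j; rewrite !mulr_ge0 ?expR_ge0 ?exprn_ge0.
- by move=> j t; rewrite mulr_ge0 ?expR_ge0.
- move=> j; apply: measurable_funM; first exact: measurable_neq0.
  apply: measurableT_comp => //; apply: measurable_funM.
    by apply: measurableT_comp => //; exact: measurable_funX.
  apply: measurable_inv_ge0.
    by move=> t; rewrite mulr_ge0// mulr_ge0// divr_ge0 ?exprn_ge0 ?ltW.
  by apply: measurable_funM => //; exact: measurable_funM.
- move=> j; apply: gauss_small_ball => //.
  by rewrite divr_gt0 ?exprn_gt0.
- move=> t [Dt /eqP Zt].
  have Nn0 c : N c t != 0.
    apply: contra Zt; rewrite psumr_eq0 => [/allP h0|j _]; last by rewrite sqr_ge0.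
    rewrite (expand_det_col _ c) big1// => j _.
    have := h0 j (mem_index_enum _); rewrite implyTb sqrf_eq0 => /eqP ->.
    by rewrite mulr0.
  pose y c := S * \det (A t) ^+ 2 / N c t.
  have d2 : 0 < \det (A t) ^+ 2 by rewrite exprn_even_gt0.
  have Np c : 0 < N c t by rewrite lt0r Nn0 N0.
  have y0 c : 0 < y c by rewrite divr_gt0// mulr_gt0.
  (* Truncation matters: a bare union bound over columns would lose [sqrt k]. *)
  apply: (@le_trans _ _ (\sum_c Num.min 1 (y c)^-1)).
    (* Either one truncated term is already [1], or no truncation occurs and membership in [D] says
       that the sum is at least [1]. *)
    have [/existsP[c yc]|/existsPn yc] := boolP [exists c, 1 <= (y c)^-1].
      rewrite (bigD1 c)//= (min_idPl yc) lerDl; apply: sumr_ge0 => j _.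
      by rewrite le_min ler01 invr_ge0 ltW.
    under eq_bigr => c _ do rewrite (min_idPr (ltW _)) ?ltNge ?yc// /y invf_div.
    rewrite -mulr_suml ler_pdivlMr; last exact: mulr_gt0.
    by rewrite mul1r; exact: Dt.
  apply: le_trans (ler_sum _ (fun c _ => gauss_mixture_ge_min n (y0 c))) _.
  rewrite big_split/= sumr_const card_ord mulr_natl lerD2l.
  rewrite -(pair_bigA _ (fun c l => w (c, l) * h (c, l) t))/=.
  apply: ler_sum => c _; apply: ler_sum => l _; rewrite /w /h /= Nn0 mul1r.
  rewrite ler_pM2l ?mulr_gt0 ?expR_gt0 ?exprn_gt0// ler_expR /y.
  rewrite le_eqVlt; apply/orP; left; apply/eqP; field.
  by rewrite Nn0 expf_neq0// gt_eqF.
Qed.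

End union_bounds.

(** * Base-[L] digits, rounding, and the deterministic distortion bound *)

Lemma digits_sum (L n l : nat) : (0 < L)%N ->
  (\sum_(e < l) (n %/ L ^ e %% L) * L ^ e)%N = (n %% L ^ l)%N.
Proof.
move=> L0; elim: l => [|l IH]; first by rewrite big_ord0 expn0 modn1.
rewrite big_ord_recr /= IH.
have Ll : (0 < L ^ l)%N by rewrite expn_gt0 L0.
have nE : n = ((n %/ L ^ l %/ L) * L ^ l.+1 + (n %% L ^ l + n %/ L ^ l %% L * L ^ l))%N.
  rewrite [LHS](divn_eq n (L ^ l)) [in LHS](divn_eq (n %/ L ^ l) L) expnS.
  by rewrite mulnDl -mulnA -addnA [(n %% _ + _)%N]addnC.
have r1 : (n %% L ^ l < L ^ l)%N by rewrite ltn_pmod.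
have r2 : (n %/ L ^ l %% L < L)%N by rewrite ltn_pmod.
rewrite [in RHS]nE modnMDl [RHS]modn_small//.
apply: (@leq_trans (L ^ l + n %/ L ^ l %% L * L ^ l)); first by rewrite ltn_add2r.
by rewrite -mulSn expnS leq_mul2r r2 orbT.
Qed.

Lemma sum_block (R : nmodType) (m l : nat) (F : nat -> R) (j : nat) :
  (0 < l)%N -> (j * l + l <= m)%N ->
  \sum_(i < m | (i %/ l == j)%N) F i = \sum_(e < l) F (j * l + e)%N.
Proof.
move=> l0 jm.
have h_lt (e : 'I_l) : (j * l + e < m)%N.
  by apply: leq_trans jm; rewrite ltn_add2l.
pose h (e : 'I_l) := Ordinal (h_lt e).
pose h' (i : 'I_m) := Ordinal (ltn_pmod i l0).
rewrite (reindex_onto h h') /=.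
  apply: eq_bigl => e; rewrite divnMDl// divn_small// addn0 eqxx /=.
  by apply/eqP/val_inj; rewrite /= modnMDl modn_small.
move=> i /eqP ij; apply/val_inj => /=.
by rewrite -ij -divn_eq.
Qed.

Lemma sum_geom_pred (R : comPzRingType) (x : R) (l : nat) :
  (x - 1) * \sum_(e < l) x ^+ e = x ^+ l - 1.
Proof.
elim: l => [|l IH]; first by rewrite big_ord0 mulr0 expr0 subrr.
by rewrite big_ord_recr/= mulrDr IH exprS; ring.
Qed.

(** Lagrange's identity, doubled so that the sum of squares runs over all ordered pairs. *)
Lemma Cauchy_Schwarz_sum (R : realDomainType) (n : nat) (a b : 'I_n -> R) :
  (\sum_i a i * b i) ^+ 2 <= (\sum_i a i ^+ 2) * \sum_i b i ^+ 2.
Proof.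
have key : (\sum_i a i ^+ 2) * (\sum_i b i ^+ 2) *+ 2 =
    (\sum_i a i * b i) ^+ 2 *+ 2 + \sum_i \sum_j (a i * b j - a j * b i) ^+ 2.
  have E : \sum_i \sum_j (a i * b j - a j * b i) ^+ 2 =
      \sum_i \sum_j (a i ^+ 2 * b j ^+ 2) + \sum_i \sum_j (b i ^+ 2 * a j ^+ 2) -
      (\sum_i \sum_j ((a i * b i) * (a j * b j))) *+ 2.
    rewrite -big_split -sumrMnl -sumrB; apply: eq_bigr => i _.
    rewrite -big_split -sumrMnl -sumrB; apply: eq_bigr => j _ /=.
    by ring.
  rewrite E -!big_distrlr/= mulrC [X in _ = _ + (_ + X - _)]mulrC.
  by rewrite expr2 mulr2n; ring.
rewrite -(ler_pMn2r (ltn0Sn 1)) key lerDl.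
by apply: sumr_ge0 => i _; apply: sumr_ge0 => j _; rewrite sqr_ge0.
Qed.

(** The strict bound [n < M] leaves room for rounding up to [n.+1] without passing the last
    level. *)
Lemma nearest_step (R : realDomainType) (step w : R) (M : nat) : (0 < M)%N ->
  0 <= w -> w <= step * M%:R ->
  exists n, [/\ (n < M)%N, step * n%:R <= w & w <= step * n.+1%:R].
Proof.
elim: M => // M IH _ w0 wM.
have [M0|M0] := posnP M.
  by exists 0%N; rewrite M0 mulr0; split=> //; rewrite M0 in wM.
have [wM'|wM'] := leP w (step * M%:R); last by exists M; split=> //; exact: ltW.
have [n [nM h1 h2]] := IH M0 w0 wM'.
by exists n; split=> //; exact: ltnW.
Qed.

(* Rounding each [p i] at random to [0] or [2 * delta] with mean [p i] has
   variance at most [delta^2]; the greedy choice does no worse than the mean. *)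
Lemma greedy_rounding (R : realFieldType) (k : nat) (I : eqType) (s : seq I)
    (g : I -> 'I_k -> R) (p : I -> R) (delta : R) : 0 < delta -> uniq s ->
  (forall i, 0 <= p i <= 2 * delta) ->
  exists b : I -> bool,
    \sum_c (\sum_(i <- s) g i c * (p i - 2 * delta * (b i)%:R)) ^+ 2 <=
    delta ^+ 2 * \sum_(i <- s) \sum_c g i c ^+ 2.
Proof.
move=> d0 + hp; elim: s => [_|i s IH /andP[iNs us]].
  exists (fun=> false); rewrite big1 => [|c _]; last by rewrite big_nil expr0n.
  by rewrite big_nil mulr0.
have [b hb] := IH us.
pose W c := \sum_(j <- s) g j c * (p j - 2 * delta * (b j)%:R).
pose A := \sum_c W c ^+ 2; pose B := \sum_c W c * g i c; pose C := \sum_c g i c ^+ 2.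
have sqE x : \sum_c (g i c * x + W c) ^+ 2 = A + 2 * x * B + x ^+ 2 * C.
  rewrite /A /B /C !mulr_sumr -!big_split /=; apply: eq_bigr => c _; ring.
have C0 : 0 <= C by apply: sumr_ge0 => c _; rewrite sqr_ge0.
pose upd_b b0 (j : I) := if j == i then b0 else b j.
have updE b0 c : \sum_(j <- i :: s) g j c * (p j - 2 * delta * (upd_b b0 j)%:R) =
    g i c * (p i - 2 * delta * b0%:R) + W c.
  rewrite big_cons /upd_b eqxx; congr (_ + _); apply: eq_big_seq => j js.
  by case: eqP => // ji; rewrite -ji js in iNs.
have [b0 hb0] : exists b0 : bool, A + 2 * (p i - 2 * delta * b0%:R) * B +
    (p i - 2 * delta * b0%:R) ^+ 2 * C <= A + delta ^+ 2 * C.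
  have /andP[p0 p2] := hp i.
  have [h|h1] := leP (A + 2 * p i * B + p i ^+ 2 * C) (A + delta ^+ 2 * C).
    by exists false; rewrite mulr0 subr0.
  have [h|h2] := leP (A + 2 * (p i - 2 * delta) * B + (p i - 2 * delta) ^+ 2 * C)
      (A + delta ^+ 2 * C).
    by exists true; rewrite mulr1.
  exfalso.
  have q0 : 0 <= 2 * delta - p i by rewrite subr_ge0.
  have f1 : 0 < 2 * p i * B + (p i ^+ 2 - delta ^+ 2) * C by lra.
  have f2 : 0 < 2 * (p i - 2 * delta) * B + ((p i - 2 * delta) ^+ 2 - delta ^+ 2) * C by lra.
  (* Weighted by [2 * delta - p i] and [p i], the linear terms in [B] cancel and the two excesses
     sum to a nonpositive number, so they cannot both be positive. *)
  have e1 : (2 * delta - p i) * (2 * p i * B + (p i ^+ 2 - delta ^+ 2) * C) +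
      p i * (2 * (p i - 2 * delta) * B + ((p i - 2 * delta) ^+ 2 - delta ^+ 2) * C) =
      - (2 * delta * (p i - delta) ^+ 2 * C) by ring.
  have e2 : 0 <= 2 * delta * (p i - delta) ^+ 2 * C.
    by rewrite mulr_ge0// mulr_ge0 ?sqr_ge0// mulr_ge0 ?ltW.
  have g1 := mulr_ge0 q0 (ltW f1); have g2 := mulr_ge0 p0 (ltW f2).
  have [pp|pp] := ltP 0 (p i).
    by have := mulr_gt0 pp f2; lra.
  have qq : 0 < 2 * delta - p i by lra.
  by have := mulr_gt0 qq f1; lra.
exists (upd_b b0); under eq_bigr do rewrite updE.
rewrite sqE big_cons [leRHS]mulrDr -/C; apply: (le_trans hb0).
by rewrite addrC lerD2l.
Qed.

(* With these radix-[L] weights, the images of the vectors over an equispaced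
   alphabet of size [L] are, in every coordinate, [L^l] equispaced points. *)
Definition block_radix_mx (R : pzRingType) (L l k m : nat) : 'M[R]_(k, m) :=
  \matrix_(j, i) (if (i %/ l == j)%N then L%:R ^+ (i %% l) else 0).

Section block_radix.
Context (R : realType) (L l k m : nat).
Hypotheses (l0 : (0 < l)%N) (klm : (k * l <= m)%N).
Local Notation V := (block_radix_mx R L l k m).

(** Column [i] is read as position [i %% l] of block [i %/ l]; columns from [k * l] on lie in no
    block and get weight zero. *)
Lemma block_radix_sum (j : 'I_k) (f : nat -> nat -> R) :
  \sum_(i < m) V j i * f (i %/ l)%N (i %% l)%N = \sum_(e < l) L%:R ^+ e * f j e.
Proof.
have jl : (j * l + l <= m)%N.
  by apply: leq_trans klm; rewrite addnC -mulSn leq_mul2r ltn_ord orbT.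
pose F i := L%:R ^+ (i %% l) * f (i %/ l)%N (i %% l)%N.
rewrite (eq_bigr (fun i : 'I_m => if (i %/ l == j)%N then F i else 0)).
  rewrite -big_mkcond (sum_block F l0 jl); apply: eq_bigr => e _.
  by rewrite /F modnMDl divnMDl// divn_small// addn0 modn_small.
by move=> i _; rewrite mxE; case: ifP => _ //; rewrite mul0r.
Qed.

(** Distinct rows have disjoint supports, and all rows carry the same weights. *)
Lemma block_radix_mul_tr :
  V *m V^T = (\sum_(e < l) (L%:R ^+ e) ^+ 2 : R)%:M.
Proof.
apply/matrixP => j j'; rewrite !mxE.
pose f (a e : nat) : R := if (a == j' :> nat) then L%:R ^+ e else 0.
rewrite (eq_bigr (fun i : 'I_m => V j i * f (i %/ l)%N (i %% l)%N)).
  rewrite block_radix_sum /f; case: eqP => [/val_inj ->|jj'].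
    by rewrite eqxx mulr1n; apply: eq_bigr => e _; rewrite expr2.
  have /negbTE -> : j != j' by apply/eqP => ?; apply: jj'; congr (nat_of_ord _).
  by rewrite mulr0n big1// => e _; rewrite mulr0.
by move=> i _; rewrite !mxE.
Qed.

Lemma block_radix_ge0 j i : 0 <= V j i.
Proof. by rewrite mxE; case: ifP => // _; rewrite exprn_ge0. Qed.

End block_radix.

Lemma DaL_le (R : realType) (L k m : nat) (E : 'M[R]_(m, k)) (mu S : R) :
  (1 < L)%N -> (0 < k)%N -> (k <= m)%N -> 0 < mu ->
  let A := block_radix_mx R L (m %/ k) k m *m E in
  (forall i, \sum_c E i c ^+ 2 <= mu ^+ 2) ->
  \sum_c \sum_j cofactor A j c ^+ 2 < S * \det A ^+ 2 ->
  (DaL E L <= (mu / (L%:R - 1) * Num.sqrt S)%:E)%E.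
Proof.
move=> L1 k0 km mu0 A rowE cofS.
set l := (m %/ k)%N; set V := block_radix_mx R L l k m; rewrite -/l -/V in A cofS *.
have l0 : (0 < l)%N by rewrite divn_gt0.
have klm : (k * l <= m)%N by rewrite mulnC leq_trunc_div.
have L1R : 0 < L%:R - 1 :> R by rewrite subr_gt0 ltr1n.
pose delta := mu / (L%:R - 1).
have d0 : 0 < delta by rewrite divr_gt0.
(* The strict inequality in [cofS] rules out a zero determinant, since its left side is
   nonnegative. *)
have detA : \det A != 0.
  apply: contraTneq cofS => ->; rewrite expr0n mulr0 -leNgt.
  by apply: sumr_ge0 => c _; apply: sumr_ge0 => j _; rewrite sqr_ge0.
have uA : A \in unitmx by rewrite unitmxE unitfE.
pose F := invmx A *m V.
have FE : F *m E = 1%:M by rewrite -mulmxA mulVmx.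
pose M := (L ^ l).-1.
have Ll : (L ^ l)%N = M.+1 by rewrite prednK// expn_gt0 ltnW.
have M0 : (0 < M)%N.
  by rewrite -ltnS -Ll -{1}(expn0 L) ltn_exp2l.
have MR : (L%:R - 1) * \sum_(e < l) L%:R ^+ e = M%:R :> R.
  by rewrite sum_geom_pred -natrX Ll -natr1 addrK.
(* The alphabet is centred, so weighted sums of its letters take the values [delta * (2 * n - M)]
   for [0 <= n <= M], symmetric about zero. *)
pose lev (n : nat) : R := delta * (2 * n%:R - (L%:R - 1)).
pose alph := [seq lev n | n <- iota 0 L].
have ualph : uniq alph.
  rewrite map_inj_uniq ?iota_uniq// => a b /(mulfI (lt0r_neq0 d0)) /addIr.
  by move=> /(mulfI (lt0r_neq0 (ltr0Sn R 1))) /eqP; rewrite eqr_nat => /eqP.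
apply: (@le_trans _ _ (Ds F alph (@unit_ball R k))).
  apply: (@le_trans _ _ (Da E alph (@unit_ball R k))).
    apply: ereal_inf_lbound; exists alph => //; split => //.
    by rewrite size_map size_iota.
  by apply: ereal_inf_lbound; exists F.
apply: ge_ereal_sup => _ [x x1 <-].
have x1' : \sum_c x c 0 ^+ 2 <= 1.
  move: x1; rewrite /unit_ball /norm2 /= => x1.
  rewrite -[leLHS]sqr_sqrtr; last by apply: sumr_ge0 => c _; rewrite sqr_ge0.
  by rewrite expr_le1// sqrtr_ge0.
have Ex i : `|(E *m x) i 0| <= mu.
  rewrite -(@ler_pXn2r _ 2) ?nnegrE ?(ltW mu0)// real_normK ?num_real// mxE.
  apply: (le_trans (Cauchy_Schwarz_sum (fun c => E i c) (fun c => x c 0))).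
  rewrite -[leRHS]mulr1; apply: ler_pM => //; apply: sumr_ge0 => c _; exact: sqr_ge0.
pose w j := (A *m x) j 0.
(* A row of [V] sums to [M / (L - 1)], so the range of [A *m x] ends exactly at the extreme
   levels. *)
have wM j : `|w j| <= delta * M%:R.
  rewrite /w -mulmxA mxE; apply: (le_trans (ler_norm_sum _ _ _)).
  apply: (@le_trans _ _ (\sum_i V j i * mu)).
    by apply: ler_sum => i _; rewrite normrM ger0_norm ?block_radix_ge0//
      ler_wpM2l ?block_radix_ge0.
  rewrite (block_radix_sum L l0 klm j (fun _ _ => mu)) -mulr_suml -MR.
  by rewrite /delta mulrA divfK ?gt_eqF// mulrC.
have /(_ _)/cid-/all_sig[n hn] : forall j : 'I_k, exists n : nat,
    [/\ (n < M)%N, 2 * delta * n%:R <= w j + delta * M%:R &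
        w j + delta * M%:R <= 2 * delta * n.+1%:R].
  move=> j; apply: nearest_step => //; move: (wM j); rewrite ler_norml => /andP[h1 h2]; lra.
pose p j := w j + delta * M%:R - 2 * delta * (n j)%:R.
have hp j : 0 <= p j <= 2 * delta.
  have [_ h1 h2] := hn j; rewrite /p subr_ge0 h1 /= lerBlDl.
  by move: h2; rewrite -(natr1 (n j)) mulrDr mulr1.
have [b hb] := greedy_rounding (fun j c => invmx A c j) d0 (index_enum_uniq _) hp.
(* [N] is the level index chosen for each block; the default [0] supplies letters for the columns
   outside the [k] blocks. *)
pose N (a : nat) := if insub a is Some j then (n j + b j)%N else 0%N.
have Nlt a : (N a < L ^ l)%N.
  rewrite /N; case: insubP => [j _ _|_]; last by rewrite expn_gt0 ltnW.
  have [nM _ _] := hn j; rewrite Ll ltnS (leq_trans _ nM)//.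
  by rewrite -addn1 leq_add2l leq_b1.
pose dg a e := (N a %/ L ^ e %% L)%N.
pose q : 'cV[R]_m := \col_i lev (dg (i %/ l)%N (i %% l)%N).
have qA : @alphabet_vecs R alph m q.
  move=> i; rewrite mxE; apply: map_f; rewrite mem_iota add0n /=.
  by rewrite ltn_pmod// ltnW.
have Vq j : (V *m q) j 0 = delta * (2 * (n j + b j)%:R - M%:R).
  rewrite mxE; under eq_bigr do rewrite [q _ _]mxE.
  rewrite (block_radix_sum L l0 klm j (fun a e => lev (dg a e))).
  have -> : (n j + b j)%N = N j by rewrite /N valK.
  rewrite -[in RHS](modn_small (Nlt j)) -digits_sum ?(ltnW L1)// natr_sum -MR.
  rewrite !mulr_sumr -sumrB !mulr_sumr; apply: eq_bigr => e _.
  by rewrite /lev /dg natrM natrX; ring.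
apply: (@le_trans _ _ (norm2 (x - F *m q))%:E).
  by apply: ereal_inf_lbound; exists q.
rewrite lee_fin -/delta.
(* Since [F = invmx A *m V], the error is [invmx A] applied to the rounding error of [A *m x]. *)
have errE c : (x - F *m q) c 0 = \sum_j invmx A c j * (p j - 2 * delta * (b j)%:R).
  have -> : x - F *m q = invmx A *m (A *m x - V *m q).
    by rewrite mulmxBr mulmxA mulVmx// mul1mx mulmxA.
  rewrite mxE; apply: eq_bigr => j _; congr (_ * _).
  rewrite mxE [in X in _ + X]mxE Vq /p /w natrD; ring.
have dS0 : 0 <= delta * Num.sqrt S by rewrite mulr_ge0 ?sqrtr_ge0 ?ltW.
rewrite -[leRHS](ger0_norm dS0) -sqrtr_sqr.
apply: ler_wsqrtr; under eq_bigr do rewrite errE.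
apply: (le_trans hb). rewrite [leRHS]exprMn; apply: ler_wpM2l; first exact: sqr_ge0.
have S0 : 0 <= S.
  rewrite -(@pmulr_lge0 _ (\det A ^+ 2)) ?exprn_even_gt0//.
  apply: le_trans (ltW cofS).
  by apply: sumr_ge0 => c _; apply: sumr_ge0 => j _; rewrite sqr_ge0.
rewrite sqr_sqrtr// exchange_big /= -(@ler_pM2r _ (\det A ^+ 2)) ?exprn_even_gt0//.
apply: le_trans (ltW cofS); rewrite mulr_suml.
apply: ler_sum => c _; rewrite mulr_suml; apply: ler_sum => j _.
rewrite /invmx uA !mxE -exprMn mulrAC mulVf// mul1r.
exact: lexx.
Qed.

(** * Numerical constants *)

Lemma expR1_lt (R : realType) : expR 1 < 284 / 100 :> R.
Proof.
have h : (1 - 1 / 16) ^+ 16 <= expR (- 1) :> R.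
  by have := @expR_ge_pow_1D R (- 1) 16; rewrite mulNr; apply => //; lra.
have h' : 36 / 100 <= (1 - 1 / 16) ^+ 16 + 1 / 200 :> R by rewrite !exprS expr0; lra.
have e0 : 0 < expR 1 :> R by exact: expR_gt0.
have : expR 1 * expR (- 1) = 1 :> R by rewrite -expRD subrr expR0.
nra.
Qed.

(** The constant [14] is split as [14 / 4 = 2 + 3 / 2]: the surplus [expR (- (3 / 2 * m))] absorbs
    [m <= 2 ^ m] and the power of [sqrt 2], because [2 * sqrt 2 <= 4 <= expR (3 / 2)]. *)
Lemma row_tail_le (R : realType) (m k : nat) : (k <= m)%N ->
  m%:R * (expR (- (14 * m%:R) / 4) * Num.sqrt 2 ^+ k) <= expR (- (2 * m%:R)) :> R.
Proof.
move=> km; have s2 : 1 <= Num.sqrt 2 :> R.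
  by rewrite -[leLHS]sqrtr1 ler_wsqrtr// ler1n.
have s2' : Num.sqrt 2 <= 2 :> R.
  by rewrite -[leRHS]ger0_norm// -sqrtr_sqr ler_wsqrtr// expr2; lra.
have e32 := expR_three_halves_ge4 R.
apply: (@le_trans _ _ (2 ^+ m * (expR (- (14 * m%:R) / 4) * Num.sqrt 2 ^+ m))).
  apply: ler_pM; first exact: ler0n.
  - by rewrite mulr_ge0 ?expR_ge0 ?exprn_ge0 ?sqrtr_ge0.
  - by rewrite -natrX ler_nat ltnW// ltn_expl.
  by rewrite ler_wpM2l ?expR_ge0// ler_weXn2l.
have -> : - (14 * m%:R) / 4 = - (2 * m%:R) + - (3 / 2 * m%:R) :> R by lra.
rewrite expRD -mulrA mulrCA -[leRHS]mulr1 ler_wpM2l ?expR_ge0//.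
rewrite mulrCA expRN expRM_natr mulrC ler_pdivrMr ?exprn_gt0 ?expR_gt0// mul1r -exprMn.
apply: lerXn2r; rewrite ?nnegrE ?mulr_ge0 ?expR_ge0 ?sqrtr_ge0//; nra.
Qed.

Lemma radix_error_lt (R : realType) (m k L l : nat) (v eps : R) :
  (0 < k)%N -> (k <= m)%N -> (2 <= L)%N -> ((m < 2 * k)%N -> (2 < L)%N) ->
  (0 < l)%N -> 0 < eps -> (L%:R ^+ l.-1) ^+ 2 <= v ->
  Num.sqrt (14 * m%:R) / (L%:R - 1) * (k%:R * (expR 2 / 2) / eps / Num.sqrt v) <
  8 * expR 1 * (m%:R * Num.sqrt m%:R) * (L%:R ^+ l)^-1 / eps.
Proof.
move=> k0 km L2 mkL l0 e0 Lv.
have m0 : 0 < m%:R :> R by rewrite ltr0n (leq_trans k0).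
have L0 : 0 < L%:R :> R by rewrite ltr0n (leq_trans _ L2).
have L1 : 0 < L%:R - 1 :> R by rewrite subr_gt0 ltr1n.
have sm0 : 0 < Num.sqrt m%:R :> R by rewrite sqrtr_gt0.
pose y : R := L%:R ^+ l.-1.
have y0 : 0 < y by rewrite exprn_gt0.
have v0 : 0 < v by apply: lt_le_trans Lv; rewrite exprn_gt0.
have yv : y <= Num.sqrt v.
  by rewrite -[leLHS]ger0_norm ?(ltW y0)// -sqrtr_sqr ler_wsqrtr.
have s14 : Num.sqrt 14 <= 375 / 100 :> R.
  rewrite -[leRHS]ger0_norm; last by lra.
  by rewrite -sqrtr_sqr ler_wsqrtr// expr2; lra.
(* The assumption [2 < L] for [m < 2 * k] enters here: then [L <= 3 / 2 * (L - 1)]; otherwise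
   [k <= m / 2] supplies the missing factor. *)
have kL : k%:R * L%:R <= 3 / 2 * m%:R * (L%:R - 1) :> R.
  have [m2k|m2k] := ltnP m (2 * k).
    have L3 : 3 <= L%:R :> R by rewrite (ler_nat R 3) mkL.
    rewrite mulrAC mulrC; apply: ler_pM => //; last by rewrite ler_nat.
    by lra.
  have km2 : k%:R <= m%:R / 2 :> R by rewrite ler_pdivlMr// -natrM ler_nat mulnC.
  have L2R : 2 <= L%:R :> R by rewrite (ler_nat R 2).
  have -> : 3 / 2 * m%:R * (L%:R - 1) = m%:R / 2 * (3 * (L%:R - 1)) :> R by ring.
  by apply: ler_pM => //; lra.
(* The margin is [3.75 * 2.84 * 1.5 = 15.975 < 16], from the bounds on [sqrt 14] and [expR 1]. *)
have key : Num.sqrt 14 * expR 1 * (k%:R * L%:R) < 16 * m%:R * (L%:R - 1) :> R.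
  have e1 := expR1_lt R; have e10 : 0 < expR 1 :> R by exact: expR_gt0.
  have s0 : 0 <= Num.sqrt 14 :> R by exact: sqrtr_ge0.
  have se : Num.sqrt 14 * expR 1 <= 375 / 100 * (284 / 100) :> R by apply: ler_pM => //; exact: ltW.
  apply: (@le_lt_trans _ _ (375 / 100 * (284 / 100) * (3 / 2 * m%:R * (L%:R - 1)))).
    by apply: ler_pM => //; rewrite mulr_ge0// ltW.
  have mL : 0 < m%:R * (L%:R - 1) :> R by exact: mulr_gt0.
  by rewrite -!mulrA; move: mL; set z := m%:R * _ => z0; lra.
rewrite sqrtrM//; have -> : (L%:R ^+ l : R) = L%:R * y by rewrite -exprS prednK.
have e2 : expR 2 = expR 1 * expR 1 :> R by rewrite -expRD.
have sv0 : 0 < Num.sqrt v by rewrite sqrtr_gt0.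
have e10 : 0 < expR 1 :> R by exact: expR_gt0.
set c : R := expR 1 * Num.sqrt m%:R / (2 * (L%:R - 1) * L%:R * y * eps).
have c0 : 0 < c by rewrite divr_gt0 ?mulr_gt0.
apply: (@le_lt_trans _ _ (c * (Num.sqrt 14 * expR 1 * (k%:R * L%:R)))).
  have -> : c * (Num.sqrt 14 * expR 1 * (k%:R * L%:R)) =
      Num.sqrt 14 * Num.sqrt m%:R / (L%:R - 1) * (k%:R * (expR 2 / 2) / eps / y).
    by rewrite /c e2; field; rewrite ?gt_eqF.
  rewrite ler_wpM2l ?divr_ge0 ?mulr_ge0 ?sqrtr_ge0 ?(ltW L1)//.
  rewrite ler_wpM2l ?divr_ge0 ?mulr_ge0 ?expR_ge0 ?(ltW e0)//.
  by rewrite lef_pV2.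
have -> : 8 * expR 1 * (m%:R * Num.sqrt m%:R) * (L%:R * y)^-1 / eps =
    c * (16 * m%:R * (L%:R - 1)).
  by rewrite /c; field; rewrite ?gt_eqF.
by rewrite ltr_pM2l.
Qed.

(** * Choice of the thresholds and conclusion *)

Theorem theorem3 (R : realType) (d : measure_display) (T : measurableType d)
  (P : probability T R) (m k L : nat) (E : 'I_m -> 'I_k -> T -> R) (eta : R) :
  (0 < k)%N -> (k <= m)%N -> (2 <= L)%N -> ((m < 2 * k)%N -> (2 < L)%N) ->
  iid_std_gaussian_matrix P E ->
  0 < eta -> eta < 1 - ((m %/ k)%N%:R * (L%:R - 1))^-1 ->
  exists A : set T, [/\ measurable A,
    A `<=` [set t | (DaL (\matrix_(i, j) E i j t) L <
                     (8 * expR 1 * m%:R `^ (3 / 2) *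
                      L%:R `^ (- ((1 - eta) * (m %/ k)%N%:R)))%:E)%E] &
    ((1 - L%:R `^ (- (eta * (m %/ k)%N%:R)) * expR (eta / (1 - eta))
        - expR (- (2 * m%:R)))%:E <= P A)%E].
Proof.
move=> k0 km L2 mkL [mE lawE indE] eta0 eta1.
pose X (p : 'I_m * 'I_k) := E p.1 p.2.
have mX p : measurable_fun setT (X p) by exact: mE.
have lawX p (B : set R) : measurable B -> P (X p @^-1` B) = normal_prob 0 1 B.
  exact: lawE.
have indX (B : 'I_m * 'I_k -> set R) : (forall p, measurable (B p)) ->
    P (\bigcap_(p in setT) X p @^-1` B p) = (\prod_p P (X p @^-1` B p))%E.
  move=> mB; have := indE (fun i j => B (i, j)) (fun i j => mB (i, j)).
  have pE (p : 'I_m * 'I_k) : B (p.1, p.2) = B p by case: p.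
  rewrite (eq_bigr (fun p => P (X p @^-1` B p))) => [<-|p _]; last by rewrite pE.
  by congr (P _); apply: eq_bigcapr => p _; rewrite pE.
set l := (m %/ k)%N in eta1 *.
have l0 : (0 < l)%N by rewrite divn_gt0.
have klm : (k * l <= m)%N by rewrite mulnC leq_trunc_div.
have m0 : 0 < m%:R :> R by rewrite ltr0n (leq_trans k0).
have L0 : 0 < L%:R :> R by rewrite ltr0n (leq_trans _ L2).
have L1 : 0 < L%:R - 1 :> R by rewrite subr_gt0 ltr1n.
have eta_lt1 : eta < 1.
  by apply: (lt_le_trans eta1); rewrite gerBl invr_ge0 mulr_ge0// ltW.
pose V := block_radix_mx R L l k m.
pose v : R := \sum_(e < l) (L%:R ^+ e) ^+ 2.
have VV : V *m V^T = v%:M by exact: block_radix_mul_tr.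
have Lv : (L%:R ^+ l.-1) ^+ 2 <= v.
  rewrite /v; case: (l) l0 => // l' _; rewrite big_ord_recr/= lerDr.
  by apply: sumr_ge0 => e _; rewrite sqr_ge0.
have v0 : 0 < v by apply: lt_le_trans Lv; rewrite !exprn_gt0.
pose eps : R := L%:R `^ (- (eta * l%:R)).
have eps0 : 0 < eps by rewrite powR_gt0.
pose q : R := k%:R * (expR 2 / 2) / eps.
have q0 : 0 < q by rewrite divr_gt0// mulr_gt0 ?ltr0n// divr_gt0 ?expR_gt0.
(* With [sqrt (S * v) = q] the bound on the inverse becomes exactly [eps]. *)
pose S := q ^+ 2 / v.
have S0 : 0 < S by rewrite divr_gt0 ?exprn_gt0.
pose a : R := 14 * m%:R.
have a0 : 0 < a by rewrite mulr_gt0.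
pose B1 := [set t | exists i, a < \sum_c X (i, c) t ^+ 2].
pose B2 := [set t | S * \det (compressed V id (X^~ t)) ^+ 2 <=
              \sum_c cofactor_col_sqr (compressed V id (X^~ t)) c].
have PB1 : (P B1 <= (expR (- (2 * m%:R)))%:E)%E.
  apply: (le_trans (large_row_bound mX lawX indX a)).
  by rewrite lee_fin row_tail_le.
have PB2 : (P B2 <= eps%:E)%E.
  apply: (le_trans (large_inverse_bound mX lawX indX VV v0 S0)).
  rewrite lee_fin /S divfK ?gt_eqF// sqrtr_sqr gtr0_norm//.
  by rewrite /q invf_div mulrCA divff ?mulr1// gt_eqF// mulr_gt0 ?ltr0n// divr_gt0 ?expR_gt0.
have mB1 : measurable B1.
  rewrite (_ : B1 = \bigcup_(i in setT) [set t | a < \sum_c X (i, c) t ^+ 2]).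
    apply: fin_bigcup_measurable; first exact: finite_finset.
    by move=> i _; apply: measurable_set_lt => //; exact: measurable_row_sqr.
  by apply/seteqP; split=> t /= [i]; [exists i|move=> _ ai; exists i].
have mB2 : measurable B2.
  apply: measurable_set_le.
    apply: measurable_funM => //; apply: measurable_funX.
    exact: measurable_det_compressed.
  by apply: measurable_sum => c; exact: measurable_cofactor_col_sqr.
have mB : measurable (B1 `|` B2) by exact: measurableU.
(* Off both exceptional events the deterministic bound applies with [mu = sqrt a]; this complement
   is measurable by construction. *)
exists (~` (B1 `|` B2)); split; first exact: measurableC.
- move=> t /not_orP[nB1 nB2] /=.
  have mu0 : 0 < Num.sqrt a by rewrite sqrtr_gt0.
  apply: (@le_lt_trans _ _ (Num.sqrt a / (L%:R - 1) * Num.sqrt S)%:E).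
    apply: DaL_le => //.
      move=> i; rewrite sqr_sqrtr ?(ltW a0)// leNgt; apply/negP => ai.
      by apply: nB1; exists i; move: ai; under eq_bigr do rewrite mxE.
    by rewrite ltNge; apply/negP.
  rewrite lte_fin.
  have -> : Num.sqrt S = q / Num.sqrt v.
    by rewrite /S sqrtrM ?sqr_ge0// sqrtr_sqr gtr0_norm// sqrtrV// ltW.
  have -> : m%:R `^ (3 / 2) = m%:R * Num.sqrt m%:R :> R.
    have -> : 3 / 2 = 1 + 2^-1 :> R by lra.
    rewrite powRD; last by apply/implyP => _; rewrite gt_eqF.
    by rewrite powRr1 ?powR12_sqrt ?ltW.
  have -> : L%:R `^ (- ((1 - eta) * l%:R)) = (L%:R ^+ l)^-1 / eps :> R.
    rewrite /eps -powRN opprK -powR_mulrn ?(ltW L0)// -powRN -powRD.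
      by congr (_ `^ _); ring.
    by apply/implyP => _; rewrite gt_eqF.
  by rewrite [ltRHS]mulrA; apply: radix_error_lt.
- rewrite probability_setC//.
  apply: (@le_trans _ _ (1 - (expR (- (2 * m%:R)) + eps)%:E)%E).
    (* The exponent [eta / (1 - eta)] is nonnegative, so a failure probability of [eps] is within
       the stated one. *)
    have h : eps <= eps * expR (eta / (1 - eta)).
      rewrite -[leLHS]mulr1 ler_pM2l// -[leLHS]expR0 ler_expR divr_ge0 ?(ltW eta0)//.
      by rewrite subr_ge0 ltW.
    by rewrite -EFinB lee_fin -/eps; lra.
  rewrite leeB// EFinD; apply: (le_trans (measureU2 _ _ _)) => //.
  exact: leeD.
Qed.
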